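(* Let $A$ be a complex abelian surface which admits multiplication by $\sqrt{d}$ for some $d\in\mathbb{Z}$ with $d<0$. Then $A$ also admits multiplication by $\sqrt{d'}$ for some integer $d'>0$ which is not a square. In particular, $\mathrm{End}_{\mathbb{Q}}(A)$ is neither an imaginary quadratic field nor a definite quaternion algebra.
   Context: A complex abelian surface is a complex torus $A=\mathbb{C}^2/\Lambda$, with $\Lambda$ a lattice (discrete subgroup of rank $4$) in $\mathbb{C}^2$, that is algebraic, i.e. for which there exists a positive definite hermitian form $H$ on $\mathbb{C}^2$ with $\mathrm{Im}\,H(\Lambda,\Lambda)\subseteq\mathbb{Z}$. For $d\in\mathbb{Z}\setminus\{n^2:n\in\mathbb{Z}\}$, the torus $A=\mathbb{C}^2/\Lambda$ is said to admit multiplication by $\sqrt{d}$ if there is an injective ring homomorphism $\mathbb{Z}[\sqrt{d}]\hookrightarrow \mathrm{End}(A)=\mathrm{End}(\Lambda)$, i.e. if there is a matrix $D\in \mathrm{M}_2(\mathbb{C})$ with $D^2=d$ (that is, $d$ times the identity matrix) and $D\Lambda\subseteq\Lambda$. Here $\mathrm{End}(\Lambda)=\{M\in\mathrm{M}_2(\mathbb{C}): M\Lambda\subseteq\Lambda\}$, and $\mathrm{End}_{\mathbb{Q}}(A)=\mathrm{End}(A)\otimes_{\mathbb{Z}}\mathbb{Q}$ is the endomorphism algebra of $A$. A definite quaternion algebra is a quaternion algebra $B$ over $\mathbb{Q}$ such that $B\otimes_{\mathbb{Q}}\mathbb{R}$ is isomorphic to Hamilton's quaternions. *)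

(* Defs.v *)
From HB Require Import structures.
From mathcomp Require Import all_boot all_order all_algebra all_field.
From mathcomp Require Import complex ring.
From mathcomp Require Import boolp classical_sets reals topology normedtype.
Set Implicit Arguments.
Unset Strict Implicit.
Unset Printing Implicit Defensive.
Import Order.TTheory GRing.Theory Num.Theory.
Import numFieldNormedType.Exports.
Local Open Scope classical_set_scope.
Local Open Scope ring_scope.
Local Open Scope complex_scope.

Definition is_square (d : int) : Prop := exists n : int, d = n ^+ 2.

Section Lattices.
Variable R : realType.

Definition int_free (V : zmodType) (n : nat) (b : 'I_n -> V) : Prop :=
  forall c : 'I_n -> int, \sum_i b i *~ c i = 0 -> forall i, c i = 0.

(* The rank of an abelian group is the largest number of its elements that   *)
(* are linearly independent over the integers.                               *)
Definition has_rank (V : zmodType) (L : set V) (n : nat) : Prop :=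
  (exists2 b : 'I_n -> V, forall i, L (b i) & int_free b) /\
  ~ (exists2 b : 'I_n.+1 -> V, forall i, L (b i) & int_free b).

(* [R[i]^o] is [R[i]] with its norm topology, whence the product topology on *)
(* column vectors.                                                           *)
Definition discrete_set (L : set 'cV[R[i]^o]_2) : Prop := L `<=` isolated L.

Record lattice := Lattice {
  lattice_set :> 'cV[R[i]]_2 -> Prop;
  lattice0 : lattice_set 0;
  latticeB : forall u v, lattice_set u -> lattice_set v -> lattice_set (u - v);
  lattice_discrete : discrete_set lattice_set;
  lattice_rank : has_rank lattice_set 4 }.

(* The complex torus C^2/L is algebraic.                                     *)
Definition is_abelian_surface (L : lattice) : Prop :=
  exists H : {dot 'cV[R[i]]_2 for @conjc R},
    forall u v, L u -> L v -> complex.Im (H u v) \is a Num.int.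

Definition End_set (L : lattice) : set 'M[R[i]]_2 :=
  [set M | forall v, L v -> L (M *m v)].

Definition admits_sqrt_mult (L : lattice) (d : int) : Prop :=
  exists2 D : 'M[R[i]]_2, D ^+ 2 = (d%:~R)%:M & End_set L D.

(* The Q-span of [End_set L]: since 'M[R[i]]_2 is a Q-vector space, the map  *)
(* N (x) q |-> q N from the tensor product of [End_set L] with Q is          *)
(* injective, and every element of that tensor product is a pure tensor.     *)
Definition endQ_pred (L : lattice) : pred 'M[R[i]]_2 :=
  fun M => `[< exists q : rat, exists2 N, End_set L N & M = ratr q *: N >].

Definition endQ_type (L : lattice) := {M : 'M[R[i]]_2 | endQ_pred L M}.

End Lattices.

Section EndQ.
Variables (R : realType) (L : lattice R).

Lemma latticeN u : L u -> L (- u).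
Proof. by move=> Lu; rewrite -sub0r; apply: latticeB => //; exact: lattice0. Qed.

Lemma latticeD u v : L u -> L v -> L (u + v).
Proof. by move=> Lu Lv; rewrite -[v]opprK; apply/latticeB/latticeN. Qed.

Lemma lattice_mulrz u (n : int) : L u -> L (u *~ n).
Proof.
move=> Lu; have Lun (k : nat) : L (u *+ k).
  elim: k => [|k IH]; first exact: lattice0.
  by rewrite mulrS; exact: latticeD.
by case: n => k; [exact: Lun | apply/latticeN/Lun].
Qed.

Lemma End_setB M N : End_set L M -> End_set L N -> End_set L (M - N).
Proof. by move=> hM hN v Lv; rewrite mulmxBl; apply: latticeB; auto. Qed.

Lemma End_set_mulrz M (n : int) : End_set L M -> End_set L (n%:~R *: M).
Proof.
move=> hM v Lv; rewrite -scalemxAl scaler_int; apply: lattice_mulrz.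
exact: hM.
Qed.

Lemma endQP M :
  reflect (exists2 n : int, n != 0 & End_set L (n%:~R *: M)) (endQ_pred L M).
Proof.
apply: (iffP (asboolP _)) => [[q [N hN ->]]|[n n0 hM]].
  exists (denq q); first by rewrite denq_neq0.
  rewrite scalerA -[_%:~R]ratr_int -rmorphM mulrC -numqE /= ratr_int.
  exact: End_set_mulrz.
exists (n%:~R^-1); exists (n%:~R *: M) => //.
rewrite scalerA fmorphV /= ratr_int mulVf ?scale1r //.
by rewrite intr_eq0.
Qed.

Fact endQ_subring : subring_closed (endQ_pred L : {pred _}).
Proof.
split=> [|M N /endQP[m m0 hM] /endQP[n n0 hN]|M N /endQP[m m0 hM] /endQP[n n0 hN]].
- by apply/endQP; exists 1 => // v; rewrite scale1r mul1mx.
- apply/endQP; exists (m * n); first by rewrite mulf_neq0.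
  rewrite scalerBr {1}[m * n]mulrC !intrM -!scalerA.
  by apply: End_setB; exact: End_set_mulrz.
- apply/endQP; exists (m * n); first by rewrite mulf_neq0.
  move=> v Lv; rewrite intrM -scalerA scalerAr scalerAl -mulmxA.
  by apply/hM/hN.
Qed.

HB.instance Definition _ :=
  [isSub of endQ_type L for @sval _ (fun M => endQ_pred L M)].
HB.instance Definition _ := [Choice of endQ_type L by <:].
HB.instance Definition _ :=
  GRing.isSubringClosed.Build _ (endQ_pred L) endQ_subring.
HB.instance Definition _ :=
  [SubChoice_isSubNzRing of endQ_type L by <:].

Fact endQ_scale_subproof (q : rat) (x : endQ_type L) :
  endQ_pred L (ratr q *: val x).
Proof.
have /asboolP[p [N hN ->]] := valP x.
by apply/asboolP; exists (q * p); exists N; rewrite // scalerA rmorphM.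
Qed.

Definition endQ_scale (q : rat) (x : endQ_type L) : endQ_type L :=
  Sub (ratr q *: val x) (endQ_scale_subproof q x).

Lemma val_endQ_scale q x : val (endQ_scale q x) = ratr q *: val x.
Proof. by rewrite SubK. Qed.

Fact endQ_scaleA a b x : endQ_scale a (endQ_scale b x) = endQ_scale (a * b) x.
Proof. by apply: val_inj; rewrite !val_endQ_scale scalerA rmorphM. Qed.
Fact endQ_scale1 : left_id 1 endQ_scale.
Proof. by move=> x; apply: val_inj; rewrite val_endQ_scale rmorph1 scale1r. Qed.
Fact endQ_scaleDr : right_distributive endQ_scale +%R.
Proof.
by move=> a x y; apply: val_inj; exact: scalerDr.
Qed.
Fact endQ_scaleDl x : {morph endQ_scale^~ x : a b / a + b}.
Proof.
by move=> a b; apply: val_inj; rewrite /= rmorphD scalerDl.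
Qed.
HB.instance Definition _ := GRing.Zmodule_isLmodule.Build rat (endQ_type L)
  endQ_scaleA endQ_scale1 endQ_scaleDr endQ_scaleDl.

Fact endQ_scaleAl (a : rat) (x y : endQ_type L) : a *: (x * y) = a *: x * y.
Proof.
by apply: val_inj; exact: scalerAl.
Qed.
Fact endQ_scaleAr (a : rat) (x y : endQ_type L) : a *: (x * y) = x * (a *: y).
Proof.
by apply: val_inj; exact: scalerAr.
Qed.
HB.instance Definition _ :=
  GRing.Lmodule_isLalgebra.Build rat (endQ_type L) endQ_scaleAl.
HB.instance Definition _ :=
  GRing.Lalgebra_isAlgebra.Build rat (endQ_type L) endQ_scaleAr.

Definition EndQ : algType rat := endQ_type L.

End EndQ.

Section BaseChange.
Variables (F K : fieldType) (phi : {rmorphism F -> K}) (B : falgType F).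

(* The tensor product of K and B over F: K-linear combinations of a chosen   *)
(* F-basis of B, multiplied through the structure constants of that basis.   *)
Definition base_change of {rmorphism F -> K} : Type := 'rV[K]_(\dim {:B}).
Local Notation BK := (base_change phi).

HB.instance Definition _ := GRing.Lmodule.copy BK 'rV[K]_(\dim {:B}).

Local Notation b := (vbasis {:B}).

Definition base_change_in (x : B) : BK := \row_k phi (coord b k x).

Definition base_change_mul (u v : BK) : BK :=
  \sum_i \sum_j (u 0 i * v 0 j) *: base_change_in (b`_i * b`_j).

Local Notation inB := base_change_in.
Local Notation "u ** v" := (base_change_mul u v) (at level 40).

Lemma base_change_in_sum (I : finType) (c : I -> F) (x : I -> B) :
  inB (\sum_i c i *: x i) = \sum_i phi (c i) *: inB (x i).
Proof.
apply/rowP => k; rewrite mxE summxE linear_sum rmorph_sum /=.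
by apply: eq_bigr => i _; rewrite !mxE linearZ /= rmorphM.
Qed.

Lemma base_change_in_basis (i : 'I_(\dim {:B})) : inB b`_i = delta_mx 0 i.
Proof.
apply/rowP => k; rewrite !mxE coord_free ?(basis_free (vbasisP _)) //.
by rewrite eqxx /= eq_sym rmorph_nat.
Qed.

Lemma base_change_expand (u : BK) : u = \sum_i u 0 i *: inB b`_i.
Proof.
rewrite {1}[u]row_sum_delta; apply: eq_bigr => i _.
by rewrite base_change_in_basis.
Qed.

Lemma base_change_mulDl : left_distributive base_change_mul +%R.
Proof.
move=> u v w; rewrite /base_change_mul -big_split; apply: eq_bigr => i _ /=.
by rewrite -big_split; apply: eq_bigr => j _; rewrite mxE mulrDl scalerDl.
Qed.

Lemma base_change_mulDr : right_distributive base_change_mul +%R.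
Proof.
move=> u v w; rewrite /base_change_mul -big_split; apply: eq_bigr => i _ /=.
by rewrite -big_split; apply: eq_bigr => j _; rewrite mxE mulrDr scalerDl.
Qed.

Lemma base_change_mulZl (a : K) (u v : BK) : a *: (u ** v) = (a *: u) ** v.
Proof.
rewrite scaler_sumr; apply: eq_bigr => i _; rewrite scaler_sumr.
by apply: eq_bigr => j _; rewrite mxE scalerA mulrA.
Qed.

Lemma base_change_mulZr (a : K) (u v : BK) : a *: (u ** v) = u ** (a *: v).
Proof.
rewrite scaler_sumr; apply: eq_bigr => i _; rewrite scaler_sumr.
by apply: eq_bigr => j _; rewrite mxE scalerA mulrCA.
Qed.

Lemma base_change_mul0l u : 0 ** u = 0.
Proof. by rewrite -(scale0r 0) -base_change_mulZl !scale0r. Qed.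

Lemma base_change_mul0r u : u ** 0 = 0.
Proof. by rewrite -(scale0r 0) -base_change_mulZr !scale0r. Qed.

Lemma base_change_ind (P : BK -> Prop) :
  P 0 -> (forall u v, P u -> P v -> P (u + v)) ->
  (forall a x, P (a *: inB x)) -> forall u, P u.
Proof.
by move=> P0 PD PZ u; rewrite (base_change_expand u); apply: big_ind => // i _.
Qed.

Lemma base_change_in_mul x y : inB (x * y) = inB x ** inB y.
Proof.
rewrite {1}(coord_vbasis (memvf x)) {1}(coord_vbasis (memvf y)) mulr_suml.
rewrite /base_change_mul.
transitivity (inB (\sum_i coord b i x *: (b`_i * \sum_j coord b j y *: b`_j))).
  by congr inB; apply: eq_bigr => i _; rewrite scalerAl.
rewrite base_change_in_sum; apply: eq_bigr => i _; rewrite mulr_sumr.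
transitivity (phi (coord b i x) *: inB (\sum_j coord b j y *: (b`_i * b`_j))).
  by congr (_ *: inB _); apply: eq_bigr => j _; rewrite scalerAr.
rewrite base_change_in_sum scaler_sumr; apply: eq_bigr => j _.
by rewrite !mxE scalerA.
Qed.

Lemma base_change_mulA : associative base_change_mul.
Proof.
move=> u v w; elim/base_change_ind: u => [|u u' IH IH'|a x].
- by rewrite !base_change_mul0l.
- by rewrite !base_change_mulDl IH IH'.
elim/base_change_ind: v => [|v v' IH IH'|a' y].
- by rewrite !(base_change_mul0l, base_change_mul0r).
- by rewrite !(base_change_mulDl, base_change_mulDr) IH IH'.
elim/base_change_ind: w => [|w w' IH IH'|a'' z].
- by rewrite !base_change_mul0r.
- by rewrite !base_change_mulDr IH IH'.
rewrite -!(base_change_mulZl, base_change_mulZr) -!base_change_in_mul mulrA.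
by rewrite !scalerA; congr (_ *: _); ring.
Qed.

Lemma base_change_mul1l : left_id (inB 1) base_change_mul.
Proof.
elim/base_change_ind => [|u v IH IH'|a x]; first exact: base_change_mul0r.
  by rewrite base_change_mulDr IH IH'.
by rewrite -base_change_mulZr -base_change_in_mul mul1r.
Qed.

Lemma base_change_mul1r : right_id (inB 1) base_change_mul.
Proof.
elim/base_change_ind => [|u v IH IH'|a x]; first exact: base_change_mul0l.
  by rewrite base_change_mulDl IH IH'.
by rewrite -base_change_mulZl -base_change_in_mul mulr1.
Qed.

Lemma base_change_1neq0 : inB 1 != 0.
Proof.
apply/eqP => h; have := oner_neq0 B; rewrite (coord_vbasis (memvf 1)).
rewrite big1 ?eqxx // => i _; have /rowP/(_ i) := h; rewrite !mxE.
by move/eqP; rewrite fmorph_eq0 => /eqP ->; rewrite scale0r.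
Qed.

HB.instance Definition _ := GRing.Zmodule_isNzRing.Build BK
  base_change_mulA base_change_mul1l base_change_mul1r
  base_change_mulDl base_change_mulDr base_change_1neq0.
HB.instance Definition _ :=
  GRing.Lmodule_isLalgebra.Build K BK base_change_mulZl.
HB.instance Definition _ :=
  GRing.Lalgebra_isAlgebra.Build K BK base_change_mulZr.

End BaseChange.

Section Hamilton.
Variable R : comNzRingType.

(* [Hamilton a b c d] is a + b i + c j + d k.                                *)
Record hamilton := Hamilton { ham1 : R; hami : R; hamj : R; hamk : R }.

Definition hamilton_to_tuple (x : hamilton) :=
  (ham1 x, hami x, hamj x, hamk x).
Definition hamilton_of_tuple (t : R * R * R * R) :=
  let: (a, b, c, d) := t in Hamilton a b c d.
Fact hamilton_to_tupleK : cancel hamilton_to_tuple hamilton_of_tuple.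
Proof. by case. Qed.
HB.instance Definition _ := Choice.copy hamilton (can_type hamilton_to_tupleK).

Definition hamilton_add (x y : hamilton) : hamilton :=
  let: Hamilton a b c d := x in let: Hamilton a' b' c' d' := y in
  Hamilton (a + a') (b + b') (c + c') (d + d').

Definition hamilton_opp (x : hamilton) : hamilton :=
  let: Hamilton a b c d := x in Hamilton (- a) (- b) (- c) (- d).

Definition hamilton_mul (x y : hamilton) : hamilton :=
  let: Hamilton a b c d := x in let: Hamilton a' b' c' d' := y in
  Hamilton (a * a' - b * b' - c * c' - d * d')
           (a * b' + b * a' + c * d' - d * c')
           (a * c' - b * d' + c * a' + d * b')
           (a * d' + b * c' - c * b' + d * a').

Definition hamilton_scale (k : R) (x : hamilton) : hamilton :=
  let: Hamilton a b c d := x in Hamilton (k * a) (k * b) (k * c) (k * d).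

Local Ltac hamilton_ring :=
  repeat case=> ? ? ? ? /=; congr Hamilton => /=; ring.

Fact hamilton_addA : associative hamilton_add.
Proof. by hamilton_ring. Qed.
Fact hamilton_addC : commutative hamilton_add.
Proof. by hamilton_ring. Qed.
Fact hamilton_add0 : left_id (Hamilton 0 0 0 0) hamilton_add.
Proof. by hamilton_ring. Qed.
Fact hamilton_addN : left_inverse (Hamilton 0 0 0 0) hamilton_opp hamilton_add.
Proof. by hamilton_ring. Qed.
HB.instance Definition _ := GRing.isZmodule.Build hamilton
  hamilton_addA hamilton_addC hamilton_add0 hamilton_addN.

Fact hamilton_mulA : associative hamilton_mul.
Proof. by hamilton_ring. Qed.
Fact hamilton_mul1l : left_id (Hamilton 1 0 0 0) hamilton_mul.
Proof. by hamilton_ring. Qed.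
Fact hamilton_mul1r : right_id (Hamilton 1 0 0 0) hamilton_mul.
Proof. by hamilton_ring. Qed.
Fact hamilton_mulDl : left_distributive hamilton_mul hamilton_add.
Proof. by hamilton_ring. Qed.
Fact hamilton_mulDr : right_distributive hamilton_mul hamilton_add.
Proof. by hamilton_ring. Qed.
Fact hamilton_1neq0 : Hamilton 1 0 0 0 != Hamilton 0 0 0 0.
Proof. by apply/eqP => -[] /eqP; rewrite oner_eq0. Qed.
HB.instance Definition _ := GRing.Zmodule_isNzRing.Build hamilton
  hamilton_mulA hamilton_mul1l hamilton_mul1r
  hamilton_mulDl hamilton_mulDr hamilton_1neq0.

Fact hamilton_scaleA a b x :
  hamilton_scale a (hamilton_scale b x) = hamilton_scale (a * b) x.
Proof. by move: x; hamilton_ring. Qed.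
Fact hamilton_scale1 : left_id 1 hamilton_scale.
Proof. by hamilton_ring. Qed.
Fact hamilton_scaleDr : right_distributive hamilton_scale hamilton_add.
Proof. by move=> k; hamilton_ring. Qed.
Fact hamilton_scaleDl x a b :
  hamilton_scale (a + b) x =
  hamilton_add (hamilton_scale a x) (hamilton_scale b x).
Proof. by move: x; hamilton_ring. Qed.
HB.instance Definition _ := GRing.Zmodule_isLmodule.Build R hamilton
  hamilton_scaleA hamilton_scale1 hamilton_scaleDr hamilton_scaleDl.

Fact hamilton_scaleAl (k : R) (x y : hamilton) : k *: (x * y) = k *: x * y.
Proof. by move: x y; hamilton_ring. Qed.
Fact hamilton_scaleAr (k : R) (x y : hamilton) : k *: (x * y) = x * (k *: y).
Proof. by move: x y; hamilton_ring. Qed.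
HB.instance Definition _ :=
  GRing.Lmodule_isLalgebra.Build R hamilton hamilton_scaleAl.
HB.instance Definition _ :=
  GRing.Lalgebra_isAlgebra.Build R hamilton hamilton_scaleAr.

End Hamilton.

Definition alg_isomorphic (F : nzRingType) (A B : algType F) : Prop :=
  exists f : {lrmorphism A -> B}, bijective f.

Definition is_quaternion_algebra (B : falgType rat) : Prop :=
  exists (i j : B) (a b : rat),
    [/\ [/\ a != 0, i ^+ 2 = a%:A, b != 0 & j ^+ 2 = b%:A],
        j * i = - (i * j) & basis_of {:B} [:: 1; i; j; i * j]].

Definition is_definite_quaternion_algebra (R : realType) (B : falgType rat) :
    Prop :=
  is_quaternion_algebra B /\
  alg_isomorphic (base_change B (ratr : {rmorphism rat -> R})) (hamilton R).

Definition is_imaginary_quadratic_field (K : fieldExtType rat) : Prop :=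
  exists (d : int) (x : K), [/\ d < 0, x ^+ 2 = d%:~R & <<1; x>>%VS = {:K}%VS].

(* Main.v *)
Require Import Defs.
From HB Require Import structures.
From mathcomp Require Import all_boot all_order all_algebra all_field.
From mathcomp Require Import complex.
From mathcomp Require Import boolp classical_sets reals topology normedtype.
From mathcomp Require Import ring lra zify.
Import Order.TTheory GRing.Theory Num.Theory.
Local Open Scope ring_scope.

(** Why the theorem holds.  Let D ^+ 2 = d < 0 with D L `<=` L, put
    delta = i sqrt(-d) and K = Q(delta), and let H be a polarization.

    Choose a basis (e1, e2) of eigenvectors of D, write v = x e1 + y e2, and
    replace y by w = y if D is scalar and by w = y^J (complex conjugate)
    otherwise.  In the coordinates (x, w) the matrix D becomes multiplication
    by delta, so the lattice is a Z[delta]-module in C^2, and the polarization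
    (in the nonscalar case its average over D) becomes the imaginary part of a
    diagonal hermitian form p x x'^J + q w w'^J.  Integrality of that imaginary
    part on L, applied to u and to delta u, shows that sqrt(-d) times the form
    takes values in Z[delta] (scaled_gram_in_order).  Now take u1, u2 in L that
    are linearly independent over C in these coordinates; they exist, for
    otherwise L would lie in a real plane, which is impossible for a discrete
    group of rank 4 (lattice_not_in_real_plane, a pigeonhole argument).  By
    Cramer's rule N L lies in Z[delta] u1 + Z[delta] u2, where N is the integer
    Gram determinant of u1, u2 (bounded_coords).

    If D is scalar, then (x, w) are complex linear coordinates, and the C-linear
    map u1 |-> u2 |-> 2 u1, multiplied by N, is an endomorphism with square
    2 N ^+ 2.

    If D is not scalar, the hermitian form is indefinite, and the map F that is
    antilinear in (x, w) and satisfies h(F u, v) ~ (u1 ^ u2) (u ^ v)^J is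
    C-linear on the torus.  By Cramer's rule again, F u1 and F u2 are
    Z[delta]-combinations of u1 and u2, so N F is an endomorphism; its square is
    the integer f = - N ^+ 3 > 0 and it anticommutes with D
    (twisted_antilinear).  Thus D and N F generate an indefinite quaternion
    algebra.  If f is not a square, N F is the required multiplication;
    otherwise f = g ^+ 2 and m N F + D has square g ^+ 2 m ^+ 2 + d, which for
    large m lies strictly between two consecutive squares.

    Neither an imaginary quadratic field nor a definite quaternion algebra
    contains a square root of a positive integer that is not a square: in
    both cases such a root would be real, hence rational. *)

Import numFieldNormedType.Exports.
Local Open Scope complex_scope.
Set Implicit Arguments.
Unset Strict Implicit.
Unset Printing Implicit Defensive.

(* The conjugation of the sesquilinear form in the definition of abelian
   surfaces; the notation of the field theory denotes another constant. *)
Local Notation "z ^J" := (conjc z) (at level 2, format "z ^J").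

Section Conjugation.
Variable R : realType.
Implicit Types z : R[i].

Lemma conjcM z z' : (z * z')^J = z^J * z'^J. Proof. exact: rmorphM. Qed.
Lemma conjcN z : (- z)^J = - z^J. Proof. exact: rmorphN. Qed.
Lemma conjcB z z' : (z - z')^J = z^J - z'^J. Proof. exact: rmorphB. Qed.
Lemma conjc_int (n : int) : (n%:~R : R[i])^J = n%:~R.
Proof. exact: (rmorph_int conjc n). Qed.

End Conjugation.

(** * Discrete groups of rank four do not lie in a real plane *)

Lemma truncn_eq_dist (R : realType) (T : nat) (x y : R) : (0 < T)%N ->
  0 <= x -> 0 <= y -> Num.truncn (x * T%:R) = Num.truncn (y * T%:R) ->
  `|x - y| < T%:R^-1.
Proof.
move=> T0 x0 y0 e; have T0' : 0 < T%:R :> R by rewrite ltr0n.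
rewrite -(ltr_pM2r T0') mulVf ?gt_eqF // -[X in _ * X](gtr0_norm T0') -normrM.
have /andP[] := truncn_itv (mulr_ge0 x0 (ltW T0')).
have /andP[] := truncn_itv (mulr_ge0 y0 (ltW T0')).
rewrite e -!natr1 mulrBl ltr_norml => *; apply/andP; split; lra.
Qed.

(** Dirichlet's pigeonhole argument: combinations of four pairs of reals with
    coefficients in [0, M[ give M ^ 4 points in a square that is covered by a
    number of cells of side 1 / T of order M ^ 2 only, so for M large two of them
    fall into the same cell. *)
Lemma small_int_relation (R : realType) (p q : 'I_4 -> R) (T : nat) :
  (0 < T)%N ->
  exists c : 'I_4 -> int, [/\ exists i, c i != 0,
    `|\sum_i (c i)%:~R * p i| < T%:R^-1 & `|\sum_i (c i)%:~R * q i| < T%:R^-1].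
Proof.
move=> T0.
have [B [B0 pB qB]] : exists B : nat,
    [/\ (0 < B)%N, forall i, `|p i| <= B%:R & forall i, `|q i| <= B%:R].
  exists (Num.truncn (\sum_i `|p i| + \sum_i `|q i|)).+1.
  have h := truncnS_gt (\sum_i `|p i| + \sum_i `|q i|).
  split=> // i; apply: (le_trans _ (ltW h)).
  - rewrite (bigD1 i) //= -addrA lerDl addr_ge0 ?sumr_ge0 //.
  - by rewrite [X in _ + X](bigD1 i) //= addrCA lerDl addr_ge0 ?sumr_ge0.
(* |p i|, |q i| <= B bound each combination by 4 M B, so that after a shift by
   4 M B it lies in [0, 8 M B] and K = 8 M B T numbers its cell; M ^ 4 exceeds
   K.+1 ^ 2 as soon as M > 8 B T. *)
pose M := (8 * B * T).+1; pose K := (8 * M * B * T)%N.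
pose S (r : 'I_4 -> R) (c : {ffun 'I_4 -> 'I_M}) : R :=
  \sum_i (c i)%:R * r i + (4 * M * B)%:R.
have SB r c : (forall i, `|r i| <= B%:R) ->
    0 <= S r c /\ (Num.truncn (S r c * T%:R) < K.+1)%N.
  move=> rB; have : `|\sum_i (c i)%:R * r i| <= (4 * M * B)%:R.
    apply: le_trans (ler_norm_sum _ _ _) _.
    have -> : (4 * M * B)%:R = \sum_(i < 4) (M * B)%:R :> R.
      by rewrite sumr_const card_ord -mulnA natrM mulr_natl.
    apply: ler_sum => i _; rewrite normrM natrM normr_nat.
    by apply: ler_pM => //; rewrite ler_nat ltnW.
  rewrite ler_norml /S => /andP[h1 h2]; split; first by lra.
  rewrite ltnS -(ler_nat R); apply: (@le_trans _ _ (S r c * T%:R)).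
    by rewrite truncn_le mulr_ge0 // /S; lra.
  have -> : K%:R = ((4 * M * B)%:R + (4 * M * B)%:R) * T%:R :> R.
    by rewrite -natrD -natrM; congr (_%:R); rewrite /K; lia.
  by rewrite ler_wpM2r // lerD2r.
pose f (c : {ffun 'I_4 -> 'I_M}) : 'I_K.+1 * 'I_K.+1 :=
  (inord (Num.truncn (S p c * T%:R)), inord (Num.truncn (S q c * T%:R))).
have /injectivePn[c [c' cc' [fp fq]]] : ~~ injectiveb f.
  apply/negP => /injectiveP /leq_card.
  rewrite card_prod card_ffun !card_ord => h; suff : (K.+1 * K.+1 < M ^ 4)%N by lia.
  rewrite /K; move: (leq0n (8 * B * T)); rewrite /M; nia.
exists (fun i => (c i : int) - (c' i : int)).
have E r : (forall i, `|r i| <= B%:R) ->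
    inord (Num.truncn (S r c * T%:R)) = inord (Num.truncn (S r c' * T%:R)) :> 'I_K.+1 ->
    `|\sum_i ((c i : int) - (c' i : int))%:~R * r i| < T%:R^-1.
  move=> rB /(congr1 val); have [Sc ?] := SB r c rB; have [Sc' ?] := SB r c' rB.
  rewrite !val_insubd; do 2!(case: ifP => [_|/negP//]).
  move=> /(truncn_eq_dist T0 Sc Sc').
  rewrite (_ : S r c - S r c' = \sum_i ((c i : int) - (c' i : int))%:~R * r i) //.
  rewrite /S opprD addrACA subrr addr0 -sumrB; apply: eq_bigr => i _.
  by rewrite intrB mulrBl.
split; [|exact: E|exact: E].
apply/existsP; rewrite -negb_forall; apply: contra cc' => /forallP h.
apply/eqP/ffunP => i; apply/val_inj/eqP; have := h i.
by rewrite subr_eq0.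
Qed.

Lemma norm_real_complex (R : realType) (x : R) : `|x%:C| = `|x|%:C.
Proof. by rewrite normc_def /= expr0n addr0 sqrtr_sqr. Qed.

Lemma lattice_sum (R : realType) (L : lattice R) (I : Type) (r : seq I)
    (F : I -> 'cV[R[i]]_2) :
  (forall i, L (F i)) -> L (\sum_(i <- r) F i).
Proof.
move=> LF; elim/big_ind: _ => //; [exact: lattice0|exact: latticeD].
Qed.

(** Four independent elements of a real plane have nonzero integer combinations
    that are arbitrarily close to 0, against discreteness. *)
Lemma lattice_not_in_real_plane (R : realType) (L : lattice R)
    (v1 v2 : 'cV[R[i]]_2) :
  ~ (forall u, L u -> exists a b : R, u = a%:C *: v1 + b%:C *: v2).
Proof.
move=> plane.
have [/cid2[b Lb bfree] _] := lattice_rank L.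
have [_ [V V0 LV]] := lattice_discrete (lattice0 L).
have [e e0 eV] : exists2 e : R, 0 < e &
    forall u : 'cV[R[i]]_2, (forall i, `|u i 0| < e%:C) -> V u.
  have /nbhs_ballP[e /= e0 eV] := V0.
  have /andP[/eqP eIm eRe] : (complex.Im e == 0) && (0 < complex.Re e).
    by move: e0; rewrite ltcE.
  exists (complex.Re e) => // u ue; apply: eV; split=> // i j.
  rewrite ord1 mxE -ball_normE /= sub0r normrN.
  by rewrite (_ : e = (complex.Re e)%:C) //; case: (e) eIm => ? ? /= ->.
have /choice[pq pqE] : forall i, exists ab : R * R, b i = ab.1%:C *: v1 + ab.2%:C *: v2.
  by move=> i; have [x [y ->]] := plane _ (Lb i); exists (x, y).
pose C : R := \sum_i (complex.Re `|v1 i 0| + complex.Re `|v2 i 0|).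
have normRe (z : R[i]) : `|z| = (complex.Re `|z|)%:C by rewrite RRe_real ?normr_real.
have C0 i : complex.Re `|v1 i 0| + complex.Re `|v2 i 0| <= C.
  rewrite /C (bigD1 i) //= lerDl sumr_ge0 // => j _.
  by rewrite addr_ge0 // -ler0c -normRe.
pose T := (Num.truncn (C / e)).+1.
have [c [[k ck] cp cq]] := @small_int_relation R (fun i => (pq i).1) (fun i => (pq i).2) T isT.
have uE : \sum_i b i *~ c i = (\sum_i (c i)%:~R * (pq i).1)%:C *: v1 +
                              (\sum_i (c i)%:~R * (pq i).2)%:C *: v2.
  rewrite !rmorph_sum !scaler_suml -big_split; apply: eq_bigr => i _ /=.
  by rewrite {1}pqE -scaler_int scalerDr !scalerA !rmorphM /= !rmorph_int.
suff /bfree/(_ k)/eqP : \sum_i b i *~ c i = 0 by rewrite (negPf ck).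
have : ([set 0]%classic : set 'cV[R[i]]_2) (\sum_i b i *~ c i); last by [].
rewrite -LV; split; last by apply: lattice_sum => i; exact: lattice_mulrz.
apply: eV => i; rewrite uE !mxE.
apply: le_lt_trans (ler_normD _ _) _; rewrite !normrM !norm_real_complex.
rewrite [`|v1 i 0|]normRe [`|v2 i 0|]normRe -!rmorphM -rmorphD ltcR.
have a0 : 0 <= complex.Re `|v1 i 0| by rewrite -ler0c -normRe.
have b0 : 0 <= complex.Re `|v2 i 0| by rewrite -ler0c -normRe.
apply: (@le_lt_trans _ _ (T%:R^-1 * C)).
  apply: (@le_trans _ _ (T%:R^-1 * (complex.Re `|v1 i 0| + complex.Re `|v2 i 0|))).
    by rewrite mulrDr; apply: lerD; apply: ler_wpM2r => //; exact: ltW.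
  by rewrite ler_wpM2l // invr_ge0 ler0n.
rewrite mulrC ltr_pdivrMr ?ltr0n // mulrC -ltr_pdivrMr //.
exact: truncnS_gt.
Qed.

(** * Modules over an imaginary quadratic order *)

(** Here delta = i s is a square root of d < 0.  The real number s is kept as a
    parameter of arbitrary sign, so that the two roots of d are treated alike. *)
Section ImaginaryOrder.
Variables (R : realType) (s : R) (d : int).
Hypothesis s2 : s ^+ 2 = (- d)%:~R.

Let delta : R[i] := Complex 0 s.

(** The order Z[delta]. *)
Definition in_order (z : R[i]) : Prop :=
  exists a b : int, z = a%:~R + b%:~R * delta.

Lemma delta_sqr : delta ^+ 2 = d%:~R.
Proof.
rewrite -[d]opprK rmorphN /= -(rmorph_int (real_complex R)) -s2 expr2.
by apply/eqP; rewrite eq_complex /=; apply/andP; split; apply/eqP; ring.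
Qed.

Lemma in_orderB z z' : in_order z -> in_order z' -> in_order (z - z').
Proof.
move=> [a [b ->]] [a' [b' ->]]; exists (a - a'), (b - b').
by rewrite !intrB; ring.
Qed.

Lemma in_orderN z : in_order z -> in_order (- z).
Proof. by move=> [a [b ->]]; exists (- a), (- b); rewrite !mulrNz mulNr opprD. Qed.

Lemma in_orderM z z' : in_order z -> in_order z' -> in_order (z * z').
Proof.
move=> [a [b ->]] [a' [b' ->]]; exists (a * a' + b * b' * d), (a * b' + b * a').
by rewrite !intrD !intrM -delta_sqr; ring.
Qed.

Lemma in_orderJ z : in_order z -> in_order z^J.
Proof.
move=> [a [b ->]]; exists a, (- b); rewrite rmorphD rmorphM !rmorph_int mulrNz.
by rewrite mulNr -mulrN; congr (_ + _ * _); apply/eqP; rewrite eq_complex /= oppr0 !eqxx.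
Qed.

Lemma in_order_nat (n : nat) : in_order n%:R.
Proof. by exists n, 0; rewrite mul0r addr0. Qed.

Lemma real_in_order z : s != 0 -> in_order z -> complex.Im z = 0 ->
  exists n : int, z = n%:~R.
Proof.
move=> s0 [a [b ->]] h; exists a; suff -> : b = 0 by rewrite mul0r addr0.
apply/eqP; rewrite -(intr_eq0 R).
move: h; rewrite -!(rmorph_int (real_complex R)) /= mul0r add0r addr0 => /eqP.
by rewrite mulf_eq0 (negPf s0) orbF.
Qed.

(** G is a Z[delta]-submodule of C^2, and h a diagonal hermitian form whose
    imaginary part is integral on G. *)
Section HermitianModule.
Variable G : R[i] * R[i] -> Prop.
Hypothesis GB : forall u v, G u -> G v -> G (u.1 - v.1, u.2 - v.2).
Hypothesis Gdelta : forall u, G u -> G (delta * u.1, delta * u.2).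

Lemma in_orderZD z z' u v : in_order z -> in_order z' -> G u -> G v ->
  G (z * u.1 + z' * v.1, z * u.2 + z' * v.2).
Proof.
have G0 w : G w -> G (0, 0) by move=> Gw; have := GB Gw Gw; rewrite !subrr.
have GN w : G w -> G (- w.1, - w.2).
  by move=> Gw; have := GB (G0 _ Gw) Gw; rewrite !sub0r.
have GD w w' : G w -> G w' -> G (w.1 + w'.1, w.2 + w'.2).
  by move=> Gw Gw'; have := GB Gw (GN _ Gw'); rewrite !opprK.
have Gnat w (n : nat) : G w -> G (n%:R * w.1, n%:R * w.2).
  move=> Gw; elim: n => [|n IH]; first by rewrite !mul0r; exact: G0 Gw.
  by have := GD _ _ IH Gw; rewrite -!natr1 !mulrDl !mul1r.
have Gint w (n : int) : G w -> G (n%:~R * w.1, n%:~R * w.2).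
  move=> Gw; case: n => n; first exact: Gnat.
  by have := GN _ (Gnat _ n.+1 Gw); rewrite NegzE mulrNz !mulNr.
have GZ w a : in_order a -> G w -> G (a * w.1, a * w.2).
  move=> [m [n ->]] Gw.
  by have := GD _ _ (Gint _ m Gw) (Gint _ n (Gdelta Gw)); rewrite /= !mulrDl -!mulrA.
by move=> hz hz' Gu Gv; have := GD _ _ (GZ _ _ hz Gu) (GZ _ _ hz' Gv).
Qed.

Variables p q : R.

Let h (u v : R[i] * R[i]) : R[i] := p%:C * u.1 * v.1^J + q%:C * u.2 * v.2^J.

Hypothesis Gint : forall u v, G u -> G v -> complex.Im (h u v) \is a Num.int.

(** The factor s turns the values of h on G into elements of Z[delta], see
    scaled_gram_in_order. *)
Definition scaled_gram (u v : R[i] * R[i]) : R[i] := s%:C * h u v.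
Local Notation g := scaled_gram.

Definition area (u v : R[i] * R[i]) : R[i] := u.1 * v.2 - v.1 * u.2.
Local Notation om := area.

(** Both coordinates of s h(u, v) in the basis (1, delta) are integral:
    Im h(u, v) is the coefficient of delta, and Im h(delta u, v) = s Re h(u, v)
    is the constant one. *)
Lemma scaled_gram_in_order u v : G u -> G v -> in_order (g u v).
Proof.
move=> Gu Gv; have /intrP[m hm] := Gint Gu Gv.
have /intrP[n hn] := Gint (Gdelta Gu) Gv.
exists n, m; rewrite -!(rmorph_int (real_complex R)) -hm -hn.
have -> : h (delta * u.1, delta * u.2) v = delta * h u v by rewrite /h /=; ring.
rewrite /g; case: (h u v) => x y.
by apply/eqP; rewrite eq_complex /=; apply/andP; split; apply/eqP; ring.
Qed.

(** The determinant of diag(p, q) after a change of basis of determinant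
    area u v. *)
Lemma gram_det u v :
  g u u * g v v - g u v * g v u = (s ^+ 2 * (p * q))%:C * (om u v * (om u v)^J).
Proof.
rewrite /g /h /om !rmorphB !rmorphM /=; ring.
Qed.

Hypotheses (s0 : s != 0) (pq0 : p * q != 0).

(** The Gram determinant lies in Z[delta] and is real, hence it is an integer. *)
Lemma gram_det_int u v : G u -> G v -> om u v != 0 ->
  exists2 N : int, N != 0 & N%:~R = g u u * g v v - g u v * g v u.
Proof.
move=> Gu Gv om0.
have [||N hN] := @real_in_order (g u u * g v v - g u v * g v u) s0.
- by apply: in_orderB; apply: in_orderM; exact: scaled_gram_in_order.
- by rewrite gram_det -sqr_normc -add_Re2_Im2 -rmorphM.
exists N => //; rewrite -(intr_eq0 R[i]) -hN gram_det.
by rewrite !mulf_neq0 ?conjc_eq0 // fmorph_eq0 mulf_neq0 // expf_neq0.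
Qed.

(** Cramer's rule.  The numerators have two expressions: as multiples of an area
    they give the coordinates of u (and are linear in u), as minors of the
    hermitian form they visibly lie in Z[delta]. *)
Lemma bounded_coords (N : int) u1 u2 : G u1 -> G u2 ->
  N%:~R = g u1 u1 * g u2 u2 - g u1 u2 * g u2 u1 ->
  forall u, G u -> let k := (s ^+ 2 * (p * q))%:C * (om u1 u2)^J in
    [/\ in_order (k * om u u2), in_order (k * om u1 u),
     N%:~R * u.1 = (k * om u u2) * u1.1 + (k * om u1 u) * u2.1 &
     N%:~R * u.2 = (k * om u u2) * u1.2 + (k * om u1 u) * u2.2].
Proof.
move=> G1 G2 hN u Gu k.
have ord v w : G v -> G w -> in_order (g v w) by exact: scaled_gram_in_order.
split.
- have -> : k * om u u2 = g u u1 * g u2 u2 - g u u2 * g u2 u1.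
    by rewrite /k /g /h /om !rmorphB !rmorphM /=; ring.
  by apply: in_orderB; apply: in_orderM; apply: ord.
- have -> : k * om u1 u = g u1 u1 * g u u2 - g u1 u2 * g u u1.
    by rewrite /k /g /h /om !rmorphB !rmorphM /=; ring.
  by apply: in_orderB; apply: in_orderM; apply: ord.
- by rewrite hN gram_det /k /om; ring.
- by rewrite hN gram_det /k /om; ring.
Qed.

End HermitianModule.
End ImaginaryOrder.

(** * Lattices in eigencoordinates *)

Section Basis.
Variables (F : fieldType) (e1 e2 : 'cV[F]_2).
Hypothesis free_e : forall x y : F, x *: e1 + y *: e2 = 0 -> x = 0 /\ y = 0.

(* The matrix with columns e1 and e2 has type 'M_(2, 1 + 1), whence the casts. *)
Lemma mul_basis_mx (c : 'cV[F]_2) :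
  (row_mx e1 e2 : 'M_2) *m c = c 0 0 *: e1 + c 1 0 *: e2.
Proof.
transitivity (e1 *m usubmx (c : 'cV_(1 + 1)) + e2 *m dsubmx (c : 'cV_(1 + 1))).
  by rewrite -mul_row_col vsubmxK.
rewrite [usubmx _]mx11_scalar [dsubmx _]mx11_scalar !mul_mx_scalar !mxE.
by congr (c _ _ *: _ + c _ _ *: _); exact: val_inj.
Qed.

Lemma basis_mx_unit : (row_mx e1 e2 : 'M_2) \in unitmx.
Proof.
rewrite -unitmx_tr -row_free_unit; apply/inj_row_free => v /(congr1 trmx).
rewrite trmx_mul trmxK trmx0 mul_basis_mx !mxE => /free_e[v0 v1].
apply/rowP => i; rewrite mxE; have [->|->] // : i = 0 \/ i = 1.
by case: i => [[|[|//]] ?]; [left|right]; exact: val_inj.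
Qed.

Lemma basis_span (v : 'cV[F]_2) : exists x y, v = x *: e1 + y *: e2.
Proof.
exists ((invmx (row_mx e1 e2 : 'M_2) *m v) 0 0).
exists ((invmx (row_mx e1 e2 : 'M_2) *m v) 1 0).
by rewrite -mul_basis_mx mulKVmx // basis_mx_unit.
Qed.

(** Every endomorphism built below has trace 0, so that its square is the scalar
    a ^+ 2 + b * c, the opposite of its determinant. *)
Lemma traceless_endomorphism (a b c : F) : exists2 M : 'M[F]_2,
  M ^+ 2 = (a ^+ 2 + b * c)%:M &
  forall x y, M *m (x *: e1 + y *: e2) = (a * x + b * y) *: e1 + (c * x - a * y) *: e2.
Proof.
pose T : 'M[F]_2 := \matrix_(i, j)
  if i == 0 then (if j == 0 then a else b) else (if j == 0 then c else - a).
pose P : 'M[F]_2 := row_mx e1 e2.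
exists (P *m T *m invmx P).
  rewrite expr2 -[_ * _]/(_ *m _) !mulmxA mulmxKV ?basis_mx_unit //.
  have TT : T *m T = (a ^+ 2 + b * c)%:M.
    apply/matrixP => i j; rewrite !mxE big_ord_recl big_ord1 !mxE /=.
    case: i j => [[|[|//]] ?] [[|[|//]] ?] /=; ring.
  by rewrite -(mulmxA P T T) TT mul_mx_scalar -scalemxAl mulmxV ?basis_mx_unit // scalemx1.
move=> x y.
pose c0 : 'cV[F]_2 := \col_i if i == 0 then x else y.
have -> : x *: e1 + y *: e2 = P *m c0 by rewrite mul_basis_mx !mxE.
rewrite mulmxA mulmxKV ?basis_mx_unit // -mulmxA mul_basis_mx !mxE.
by rewrite !big_ord_recl !big_ord0 !mxE /= !addr0 mulNr.
Qed.

End Basis.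

Section LatticeCoordinates.
Variables (R : realType) (L : lattice R) (d : int) (s : R).
Hypotheses (s2 : s ^+ 2 = (- d)%:~R) (s0 : s != 0).
Let delta : R[i] := Complex 0 s.
Variables (e1 e2 : 'cV[R[i]]_2).
Hypothesis free_e : forall x y : R[i], x *: e1 + y *: e2 = 0 -> x = 0 /\ y = 0.

(** The twisted second coordinate w = twist k y makes D act as the scalar delta:
    k = false is for D scalar, and k = true for D = diag(delta, - delta), since
    the conjugate of - delta is delta. *)
Definition twist (k : bool) (z : R[i]) : R[i] := if k then z^J else z.

Lemma twistK k : involutive (twist k).
Proof. by case: k => // z; exact: conjcK. Qed.
Lemma twistB k z z' : twist k (z - z') = twist k z - twist k z'.
Proof. by case: k; rewrite //= rmorphB. Qed.
Lemma twistD k z z' : twist k (z + z') = twist k z + twist k z'.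
Proof. by case: k; rewrite //= rmorphD. Qed.
Lemma twistM k z z' : twist k (z * z') = twist k z * twist k z'.
Proof. by case: k; rewrite //= rmorphM. Qed.
Lemma twist_real k (x : R) : twist k x%:C = x%:C.
Proof. by case: k; rewrite // -[LHS]/(x%:C^J) conjc_real. Qed.

Definition coord_lattice (k : bool) (u : R[i] * R[i]) : Prop :=
  L (u.1 *: e1 + twist k u.2 *: e2).

Lemma coord_latticeB k u v : coord_lattice k u -> coord_lattice k v ->
  coord_lattice k (u.1 - v.1, u.2 - v.2).
Proof.
move=> Gu Gv; have := latticeB Gu Gv.
by rewrite /coord_lattice /= twistB !scalerBl opprD addrACA.
Qed.

(** Were all areas 0, the twisted coordinates would lie on one complex line C u;
    since twist is real linear, L would then lie in the real plane spanned by
    the vectors of coordinates u and i u. *)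
Lemma exists_area_neq0 k : exists u v,
  [/\ coord_lattice k u, coord_lattice k v & area u v != 0].
Proof.
apply: contrapT => noarea.
have om0 u v : coord_lattice k u -> coord_lattice k v -> area u v = 0.
  by move=> Gu Gv; apply/eqP; apply: contrapT => /negP h; apply: noarea; exists u, v.
have coordP v : L v -> exists2 u, coord_lattice k u & v = u.1 *: e1 + twist k u.2 *: e2.
  have [x [y ->]] := basis_span free_e v => Lv.
  by exists (x, twist k y); rewrite /coord_lattice /= twistK.
have [[u Gu u0]|all0] := pselect (exists2 u, coord_lattice k u & u != (0, 0)); last first.
  apply: (@lattice_not_in_real_plane _ L 0 0) => v /coordP[u Gu ->].
  exists 0, 0; have /eqP -> : u == (0, 0).
    by apply: contrapT => /negP h; apply: all0; exists u.
  by rewrite /= -[0]/((0 : R)%:C) twist_real !scale0r.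
apply: (@lattice_not_in_real_plane _ L (u.1 *: e1 + twist k u.2 *: e2)
         (('i%C * u.1) *: e1 + twist k ('i%C * u.2) *: e2)) => v /coordP[w Gw ->].
have [t [-> ->]] : exists t, w.1 = t * u.1 /\ w.2 = t * u.2.
  have /eqP := om0 _ _ Gu Gw; rewrite /area subr_eq0 => /eqP h.
  have [u10|u10] := eqVneq u.1 0.
    have u20 : u.2 != 0.
      by apply: contra u0 => /eqP u20; move: u10 u20; case: (u) => ? ? /= -> ->.
    exists (w.2 / u.2); rewrite divfK // u10 mulr0; split=> //.
    by apply/eqP; move/esym/eqP: h; rewrite u10 mul0r mulf_eq0 (negPf u20) orbF.
  exists (w.1 / u.1); rewrite divfK //; split=> //.
  by rewrite mulrAC -h mulrC mulKf.
exists (complex.Re t), (complex.Im t).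
rewrite {1 2}[t]complexE !scalerDr !scalerA addrACA -!scalerDl !(twistM, twistD) !twist_real.
by congr (_ *: _ + _ *: _); ring.
Qed.

Lemma endomorphismP k (M : 'M[R[i]]_2) (a b c : R[i]) :
  (forall x y, M *m (x *: e1 + y *: e2) =
     (a * x + b * y) *: e1 + (c * x - a * y) *: e2) ->
  (forall u, coord_lattice k u ->
     coord_lattice k (a * u.1 + b * twist k u.2,
                      twist k (c * u.1 - a * twist k u.2))) ->
  End_set L M.
Proof.
move=> ME MG v; have [x [y ->]] := basis_span free_e v => Lv; rewrite ME.
have := MG (x, twist k y); rewrite /coord_lattice /= !twistK; exact.
Qed.

Section Hermitian.
Variables (k : bool) (p q : R).
Hypothesis pq0 : p * q != 0.
Local Notation G := (coord_lattice k).
Hypothesis Gdelta : forall u, G u -> G (delta * u.1, delta * u.2).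
Hypothesis Gint : forall u v, G u -> G v ->
  complex.Im (p%:C * u.1 * v.1^J + q%:C * u.2 * v.2^J) \is a Num.int.


Lemma exists_bounded_coords : exists u1 u2 (N : int),
  let c := (s ^+ 2 * (p * q))%:C * (area u1 u2)^J in
  [/\ G u1, G u2, N != 0, N%:~R = c * area u1 u2 & forall u, G u ->
    [/\ in_order s (c * area u u2), in_order s (c * area u1 u),
     N%:~R * u.1 = (c * area u u2) * u1.1 + (c * area u1 u) * u2.1 &
     N%:~R * u.2 = (c * area u u2) * u1.2 + (c * area u1 u) * u2.2]].
Proof.
have [u1 [u2 [G1 G2 om0]]] := exists_area_neq0 k.
have [N N0 hN] := gram_det_int s2 Gdelta Gint s0 pq0 G1 G2 om0.
exists u1, u2, N => c; split=> //; first by rewrite hN gram_det /c; ring.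
move=> u Gu; exact: (bounded_coords s2 Gdelta Gint G1 G2 hN Gu).
Qed.

End Hermitian.

(** The map u1 |-> u2 |-> 2 u1 has square 2.  If N u = a u1 + b u2 with a and b in
    Z[delta], then N times this map sends u to a u2 + 2 b u1, which is in L. *)
Lemma scalar_real_mult (p q : R) : p * q != 0 ->
  (forall u, coord_lattice false u ->
     coord_lattice false (delta * u.1, delta * u.2)) ->
  (forall u v, coord_lattice false u -> coord_lattice false v ->
    complex.Im (p%:C * u.1 * v.1^J + q%:C * u.2 * v.2^J) \is a Num.int) ->
  exists2 N : int, N != 0 & admits_sqrt_mult L (2 * N ^+ 2).
Proof.
move=> pq0 Gdelta Gint.
have [u1 [u2 [N [G1 G2 N0 hN coords]]]] := exists_bounded_coords pq0 Gdelta Gint.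
set c := _ * _^J in hN coords.
exists N => //.
(* The matrix of u |-> c (area u u2) u2 + 2 c (area u1 u) u1. *)
have [M MM ME] := traceless_endomorphism free_e (c * (u2.2 * u2.1 - 2 * u1.2 * u1.1))
  (c * (2 * u1.1 ^+ 2 - u2.1 ^+ 2)) (c * (u2.2 ^+ 2 - 2 * u1.2 ^+ 2)).
exists M; first by rewrite MM intrM rmorphXn /= hN /area; congr _%:M; ring.
apply: (endomorphismP (k := false) ME) => u Gu.
have [o1 o2 _ _] := coords u Gu.
have := in_orderZD (@coord_latticeB false) Gdelta
  (in_orderM s2 (in_order_nat s 2) o2) o1 G1 G2.
by congr (coord_lattice _ (_, _)); rewrite /area /=; ring.
Qed.

(** The map F = (x, w) |-> (- s q om w^J, s p om x^J), where om = area u1 u2, is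
    antilinear in the twisted coordinates and satisfies
    F u1 = g11 u2 - g21 u1 and F u2 = g12 u2 - g22 u1, where (gij) is the scaled
    Gram matrix of u1, u2.  Hence F multiplies L into L up to the factor N.  In the
    coordinates (x, y) with y = w^J, N F becomes (x, y) |-> (b y, c x), which is
    complex linear.  Its square b c = - N ^+ 3 is positive because the form is
    indefinite, that is, p q < 0. *)
Lemma twisted_antilinear (p q : R) : p * q < 0 ->
  (forall u, coord_lattice true u ->
     coord_lattice true (delta * u.1, delta * u.2)) ->
  (forall u v, coord_lattice true u -> coord_lattice true v ->
    complex.Im (p%:C * u.1 * v.1^J + q%:C * u.2 * v.2^J) \is a Num.int) ->
  exists (f : int) (b c : R[i]), [/\ 0 < f, b * c = f%:~R &
    forall u, coord_lattice true u ->
      coord_lattice true (b * u.2^J, c^J * u.1^J)].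
Proof.
move=> pq0 Gdelta Gint.
have [u1 [u2 [N [G1 G2 N0 hN coords]]]] :=
  exists_bounded_coords (ltr0_neq0 pq0) Gdelta Gint.
set c := _ * _^J in hN coords.
have NE : - N%:~R = (s * s * - (p * q))%:C * `|area u1 u2| ^+ 2.
  by rewrite hN /c sqr_normc !rmorphM !rmorphN !rmorphM; ring.
exists (- N ^+ 3), (N%:~R * - (s * q)%:C * area u1 u2).
exists (N%:~R * (s * p)%:C * (area u1 u2)^J).
split.
- have : (0 : R[i]) < - N%:~R.
    rewrite lt0r oppr_eq0 intr_eq0 N0 NE mulr_ge0 ?exprn_ge0 ?normr_ge0 // ler0c.
    by rewrite mulr_ge0 ?oppr_ge0 ?(ltW pq0) // -expr2 sqr_ge0.
  rewrite oppr_gt0 ltrz0 oppr_gt0 => N_lt0.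
  by rewrite exprSr pmulr_rlt0 // exprn_even_gt0.
- by rewrite mulrNz rmorphXn /= [in RHS]exprS -mulrN [X in _ = X * _]hN /c; ring.
move=> u Gu.
have [/in_orderJ o1 /in_orderJ o2 h1 h2] := coords u Gu.
set A := (c * area u u2)^J in o1; set B := (c * area u1 u)^J in o2.
have ord v w : coord_lattice true v -> coord_lattice true w ->
  in_order s (scaled_gram s p q v w) by exact: scaled_gram_in_order.
have J1 : N%:~R * u.1^J = A * u1.1^J + B * u2.1^J.
  by rewrite -(rmorph_int conjc N) -rmorphM h1 rmorphD rmorphM [X in _ + X]rmorphM.
have J2 : N%:~R * u.2^J = A * u1.2^J + B * u2.2^J.
  by rewrite -(rmorph_int conjc N) -rmorphM h2 rmorphD rmorphM [X in _ + X]rmorphM.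
(* N F u = F (N u) = A (F u1) + B (F u2), expanded in u2 and u1. *)
have := in_orderZD (@coord_latticeB true) Gdelta
  (in_orderB (in_orderM s2 o1 (ord _ _ G1 G1))
             (in_orderM s2 (in_orderN o2) (ord _ _ G1 G2)))
  (in_orderB (in_orderM s2 (in_orderN o1) (ord _ _ G2 G1))
             (in_orderM s2 o2 (ord _ _ G2 G2)))
  G2 G1.
congr (coord_lattice _ (_, _)).
- transitivity (- (s * q)%:C * area u1 u2 * (N%:~R * u.2^J)); last by rewrite /=; ring.
  rewrite J2 /scaled_gram /area !rmorphM /=; ring.
- transitivity ((s * p)%:C * area u1 u2 * (N%:~R * u.1^J)).
    rewrite J1 /scaled_gram /area !rmorphM /=; ring.
  rewrite !conjcM conjcK conjc_real conjc_int; ring.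
Qed.

End LatticeCoordinates.

(** * Real multiplication *)

(** The exponent of 2 in 2 N ^+ 2 is odd. *)
Lemma double_square_not_square (N : int) : N != 0 -> ~ is_square (2 * N ^+ 2).
Proof.
move=> N0 [n /(congr1 absz)]; rewrite !expr2 !abszM => h.
have N0' : (0 < `|N|)%N by rewrite absz_gt0.
have n0' : (0 < `|n|)%N.
  by rewrite lt0n; apply: contraTneq N0' => n0; move: h; rewrite n0; lia.
move/(congr1 (logn 2)): h.
rewrite !lognM ?muln_gt0 ?N0' // (_ : logn 2 `|2| = 1%N) //; lia.
Qed.

(** With m = 1 - d one has g m > - d, so the number lies strictly between
    (g m - 1) ^+ 2 and (g m) ^+ 2. *)
Lemma shifted_square_not_square (d g : int) : d < 0 -> 0 < g ->
  let m := 1 - d in 0 < g ^+ 2 * m ^+ 2 + d /\ ~ is_square (g ^+ 2 * m ^+ 2 + d).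
Proof.
move=> d0 g0 m; have m1 : 1 - d <= g * m by rewrite /m; nia.
have -> : g ^+ 2 * m ^+ 2 + d = (g * m) ^+ 2 + d by ring.
split; first by nia.
move=> [n]; rewrite -(real_normK (num_real n)); move: (normr_ge0 n) => n0 h.
have h1 : `|n| < g * m by nia.
have h2 : g * m - 1 < `|n| by nia.
lia.
Qed.

(** A nonzero column of D - b is killed by D - a. *)
Lemma exists_eigenvector (F : fieldType) (n : nat) (D : 'M[F]_n) (a b : F) :
  (D - a%:M) *m (D - b%:M) = 0 -> D != b%:M ->
  exists2 e : 'cV[F]_n, e != 0 & D *m e = a *: e.
Proof.
move=> Dab; rewrite -subr_eq0 => /matrix0Pn[i [j Mij]].
exists (col j (D - b%:M)).
  by apply: contra Mij => /eqP/colP/(_ i); rewrite !mxE => ->.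
by apply/eqP; rewrite -subr_eq0 -mul_scalar_mx -mulmxBl colE mulmxA Dab mul0mx eqxx.
Qed.

Section Surface.
Variables (R : realType) (L : lattice R) (H : {dot 'cV[R[i]]_2 for @conjc R}).
Hypothesis Hint : forall u v, L u -> L v -> complex.Im (H u v) \is a Num.int.

Lemma dot_real e : H e e = (complex.Re (H e e))%:C.
Proof.
have [->|/neq0_dnorm_gt0 h] := eqVneq e 0; first by rewrite linear0l.
by rewrite RRe_real // gtr0_real.
Qed.

Lemma dot_Re_gt0 e : e != 0 -> 0 < complex.Re (H e e).
Proof. by move=> e0; rewrite -ltcR -dot_real neq0_dnorm_gt0. Qed.

Lemma dotC u v : H u v = (H v u)^J.
Proof. by rewrite [LHS]hermC expr0 mul1r. Qed.

Lemma dot_linearl x y u v w : H (x *: u + y *: v) w = x * H u w + y * H v w.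
Proof. by rewrite linearDl !linearZl_LR. Qed.

Lemma dot_expand e1 e2 x y x' y' : H (x *: e1 + y *: e2) (x' *: e1 + y' *: e2) =
  x * x'^J * H e1 e1 + x * y'^J * H e1 e2 + y * x'^J * H e2 e1 + y * y'^J * H e2 e2.
Proof.
by rewrite !linearDl !linearDr !linearZl_LR !linearZr_LR /=; ring.
Qed.

Variables (d : int) (s : R).
Hypotheses (d0 : d < 0) (s2 : s ^+ 2 = (- d)%:~R).
Let delta : R[i] := Complex 0 s.

Lemma sqrt_neq0 : s != 0.
Proof. by rewrite -sqrf_eq0 s2 intr_eq0 oppr_eq0 lt_eqF. Qed.

Lemma delta_neq0 : delta != 0.
Proof. by rewrite -sqrf_eq0 (delta_sqr s2) intr_eq0 lt_eqF. Qed.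

Lemma deltaJ : delta^J = - delta.
Proof. by apply/eqP; rewrite eq_complex /= oppr0 !eqxx. Qed.

Lemma conjc_delta_mul z : (delta * z)^J = - delta * z^J.
Proof. by rewrite -deltaJ; exact: rmorphM. Qed.

(** Any H-orthogonal basis diagonalizes D, and it makes H diagonal. *)
Lemma real_mult_of_scalar : End_set L delta%:M ->
  exists d' : int, [/\ 0 < d', ~ is_square d' & admits_sqrt_mult L d'].
Proof.
move=> LD.
pose e1 : 'cV[R[i]]_2 := delta_mx 0 0; pose f : 'cV[R[i]]_2 := delta_mx 1 0.
have e10 : e1 != 0.
  by apply/eqP => /colP/(_ 0); rewrite !mxE => /eqP; rewrite oner_eq0.
pose e2 := f - (H f e1 / H e1 e1) *: e1.
have e20 : e2 != 0.
  by apply/eqP => /colP/(_ 1); rewrite !mxE /= mulr0 subr0 => /eqP; rewrite oner_eq0.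
have H11 : H e1 e1 != 0 by rewrite gt_eqF // neq0_dnorm_gt0.
have H22 : H e2 e2 != 0 by rewrite gt_eqF // neq0_dnorm_gt0.
have H21 : H e2 e1 = 0 by rewrite linearBl linearZl_LR /= divfK // subrr.
have H12 : H e1 e2 = 0 by rewrite dotC H21 conjc0.
have free_e (x y : R[i]) : x *: e1 + y *: e2 = 0 -> x = 0 /\ y = 0.
  move=> h; split; apply/eqP.
  - have /eqP : H (x *: e1 + y *: e2) e1 = 0 by rewrite h linear0l.
    by rewrite dot_linearl H21 mulr0 addr0 mulf_eq0 (negPf H11) orbF.
  - have /eqP : H (x *: e1 + y *: e2) e2 = 0 by rewrite h linear0l.
    by rewrite dot_linearl H12 mulr0 add0r mulf_eq0 (negPf H22) orbF.
have [||N N0 LN] := @scalar_real_mult R L d s s2 sqrt_neq0 e1 e2 free_e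
    (complex.Re (H e1 e1)) (complex.Re (H e2 e2))
    (lt0r_neq0 (mulr_gt0 (dot_Re_gt0 e10) (dot_Re_gt0 e20))).
- move=> u /LD; rewrite /coord_lattice /= mul_scalar_mx scalerDr !scalerA; exact.
- move=> u v Lu Lv; have := Hint Lu Lv.
  rewrite dot_expand H12 H21 !mulr0 !addr0 -!dot_real.
  by rewrite mulrC [X in _ + X]mulrC !mulrA.
exists (2 * N ^+ 2); split=> //; last exact: double_square_not_square.
by rewrite pmulr_rgt0 // exprn_even_gt0.
Qed.

(** Eigenvectors e1, e2 of D need not be orthogonal for H, but they are for the
    averaged form H(D u, D v) - d H(u, v), which is also integral on L: its cross
    terms carry the factor delta * delta - d = 0, and its diagonal terms the
    factor - 2 d > 0.  In twisted coordinates the imaginary part of y y'^J changes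
    sign, whence the sign of q and an indefinite form. *)
Lemma real_mult_of_nonscalar (D : 'M[R[i]]_2) : End_set L D ->
  D ^+ 2 = (d%:~R)%:M -> D != delta%:M -> D != (- delta)%:M ->
  exists d' : int, [/\ 0 < d', ~ is_square d' & admits_sqrt_mult L d'].
Proof.
move=> LD D2 Dp Dn.
have DD : D *m D = (delta * delta)%:M.
  by rewrite -expr2 (delta_sqr s2) -D2 expr2.
have DaDN (a : R[i]) : a * a = delta * delta -> (D - a%:M) *m (D - (- a)%:M) = 0.
  move=> aa; rewrite raddfN /= opprK mulmxBl !mulmxDr DD mul_scalar_mx mul_mx_scalar.
  by rewrite mul_scalar_mx scale_scalar_mx aa [X in _ - X]addrC subrr.
have [e1 e10 De1] : exists2 e : 'cV[R[i]]_2, e != 0 & D *m e = delta *: e.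
  by apply: exists_eigenvector Dn; exact: DaDN.
have [e2 e20 De2] : exists2 e : 'cV[R[i]]_2, e != 0 & D *m e = (- delta) *: e.
  by apply: exists_eigenvector Dp; rewrite -{2}[delta]opprK DaDN // mulrNN.
have De x y : D *m (x *: e1 + y *: e2) = (delta * x) *: e1 + (- delta * y) *: e2.
  by rewrite mulmxDr -!scalemxAr De1 De2 !scalerA mulrC [y * _]mulrC.
have free_e (x y : R[i]) : x *: e1 + y *: e2 = 0 -> x = 0 /\ y = 0.
  move=> h; have := De x y; rewrite h mulmx0 => /esym h'.
  have hx : delta *: (x *: e1 + y *: e2) + ((delta * x) *: e1 + (- delta * y) *: e2) = 0.
    by rewrite h h' scaler0 addr0.
  have x0 : x = 0.
    move/eqP: hx; rewrite scalerDr !scalerA mulNr scaleNr addrACA subrr addr0 -scalerDl.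
    rewrite scaler_eq0 (negPf e10) orbF -mulr2n -mulr_natl !mulf_eq0 (negPf delta_neq0).
    by rewrite pnatr_eq0 => /eqP.
  split=> //; move/eqP: h; rewrite x0 scale0r add0r scaler_eq0 (negPf e20) orbF.
  by move/eqP.
pose p := (- 2 * d)%:~R * complex.Re (H e1 e1).
pose q := - ((- 2 * d)%:~R * complex.Re (H e2 e2)).
have d2 : 0 < (- 2 * d)%:~R :> R by rewrite ltr0z; lia.
have pq0 : p * q < 0.
  by rewrite mulrN oppr_lt0 !mulr_gt0 ?dot_Re_gt0.
have Gdelta u : coord_lattice L e1 e2 true u ->
    coord_lattice L e1 e2 true (delta * u.1, delta * u.2).
  by move=> /LD; rewrite De /coord_lattice /twist /= conjc_delta_mul.
have [|f [b [c [f0 bc Gbc]]]] := twisted_antilinear s2 sqrt_neq0 free_e pq0 Gdelta.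
  move=> u v Gu Gv.
  have /intrP[m hm] := Hint Gu Gv.
  have /intrP[n hn] := Hint (LD _ Gu) (LD _ Gv).
  apply/intrP; exists (n - d * m); rewrite intrB intrM -hm -hn.
  have ImB (y z : R[i]) : complex.Im (y - d%:~R * z) =
      complex.Im y - d%:~R * complex.Im z.
    rewrite -(rmorph_int (real_complex R)).
    by case: y z => [? ?] [? ?] /=; ring.
  have pE : p%:C = (- 2 * d)%:~R * H e1 e1.
    by rewrite dot_real -(rmorph_int (real_complex R)) -rmorphM.
  have qE : q%:C = - ((- 2 * d)%:~R * H e2 e2).
    by rewrite dot_real -(rmorph_int (real_complex R)) -rmorphM -rmorphN.
  have ImJ (y z : R[i]) : complex.Im (y + z) = complex.Im (y - z^J).
    by case: y z => [? ?] [? ?] /=; rewrite opprK.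
  rewrite -ImB [LHS]ImJ; congr complex.Im; rewrite !De !dot_expand /twist.
  rewrite !conjc_delta_mul !mulNr !conjcN !conjc_delta_mul !conjcM conjc_real !conjcK.
  by rewrite pE qE intrM -(delta_sqr s2) -/delta mulrNz; ring.
(* The endomorphism r D + m G, where G : (x, w) |-> (b w^J, c^J x^J) anticommutes
   with D and has square f. *)
have mult (r m : int) : admits_sqrt_mult L (f * m ^+ 2 + r ^+ 2 * d).
  have [M MM ME] := traceless_endomorphism free_e (r%:~R * delta) (m%:~R * b) (m%:~R * c).
  exists M.
    by rewrite MM intrD !intrM -bc -(delta_sqr s2) -/delta; congr _%:M; ring.
  apply: (endomorphismP free_e (k := true) ME) => u Gu.
  have Gbcu := Gbc _ Gu.
  have -> : (r%:~R * delta * u.1 + m%:~R * b * twist true u.2,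
    twist true (m%:~R * c * u.1 - r%:~R * delta * twist true u.2)) =
    (r%:~R * (delta * u.1) + m%:~R * (b * u.2^J), r%:~R * (delta * u.2) + m%:~R * (c^J * u.1^J)).
    congr (_, _); rewrite /twist; first by ring.
    rewrite conjcB !conjcM deltaJ conjcK !conjc_int; ring.
  have int_ord (n : int) : in_order s n%:~R by exists n, 0; rewrite mul0r addr0.
  exact: (in_orderZD (@coord_latticeB _ L e1 e2 true) Gdelta
            (int_ord r) (int_ord m) (Gdelta _ Gu) Gbcu).
have [[g fg]|fnsq] := pselect (is_square f); last first.
  by exists f; split=> //; have := mult 0 1; rewrite expr1n mulr1 expr0n mul0r addr0.
have g0 : 0 < `|g| by rewrite normr_gt0; apply: contraTneq f0 => g0; rewrite fg g0.
have [h1 h2] := shifted_square_not_square d0 g0.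
exists (`|g| ^+ 2 * (1 - d) ^+ 2 + d); split => //.
by have := mult 1 (1 - d); rewrite expr1n mul1r fg real_normK ?num_real.
Qed.

End Surface.

Lemma real_multiplication (R : realType) (L : lattice R) (d : int) :
  is_abelian_surface L -> d < 0 -> admits_sqrt_mult L d ->
  exists d' : int, [/\ 0 < d', ~ is_square d' & admits_sqrt_mult L d'].
Proof.
move=> [H Hint] d0 [D D2 LD].
pose s : R := Num.sqrt (- d)%:~R.
have s2 : s ^+ 2 = (- d)%:~R by rewrite sqr_sqrtr // ler0z oppr_ge0 ltW.
have [Dp|Dp] := eqVneq D (Complex 0 s)%:M.
  by apply: (real_mult_of_scalar Hint d0 s2); rewrite -Dp.
have [Dn|Dn] := eqVneq D (- Complex 0 s)%:M.
  apply: (@real_mult_of_scalar _ _ _ Hint d (- s)) => //; first by rewrite sqrrN.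
  rewrite (_ : Complex 0 (- s) = - Complex 0 s) -?Dn //.
  by apply/eqP; rewrite eq_complex /= oppr0 !eqxx.
exact: (real_mult_of_nonscalar Hint d0 s2 LD).
Qed.

(** * Square roots in the endomorphism algebra *)

(** The integers are integrally closed. *)
Lemma rat_square_int (d : int) (r : rat) : r ^+ 2 = d%:~R -> is_square d.
Proof.
move=> r2; have hz : numq r ^+ 2 = d * denq r ^+ 2.
  apply/eqP; rewrite -(eqr_int rat) intrM -r2 !rmorphXn /=.
  by rewrite -exprMn -numqE.
have den1 : `|denq r|%N = 1%N.
  have cop : coprime (`|denq r| ^ 2) (`|numq r| ^ 2).
    by rewrite coprimeXl // coprimeXr // coprime_sym coprime_num_den.
  have dvd : (`|denq r| ^ 2 %| `|numq r| ^ 2)%N.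
    by rewrite -!abszX hz abszM dvdn_mull // abszX.
  have : (`|denq r| ^ 2 %| gcdn (`|denq r| ^ 2) (`|numq r| ^ 2))%N.
    by rewrite dvdn_gcd dvdnn.
  rewrite (eqP cop) dvdn1 => /eqP; rewrite -!mulnn; nia.
exists (numq r); rewrite hz (_ : denq r = 1) ?expr1n ?mulr1 //.
by rewrite -absz_denq den1.
Qed.

Lemma EndQ_sqrt (R : realType) (L : lattice R) (d : int) :
  admits_sqrt_mult L d -> exists z : EndQ L, z ^+ 2 = d%:~R.
Proof.
move=> [M M2 LM].
have zP : endQ_pred L M by apply/endQP; exists 1 => //; rewrite scale1r.
exists (exist _ M zP : endQ_type L).
apply: val_inj; rewrite [RHS]rmorph_int.
have := M2; rewrite -[(_)%:M]/(scalar_mx _).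
rewrite [X in _ = X -> _](rmorph_int (@scalar_mx R[i] 2)) => <-.
by rewrite !expr2.
Qed.

(** For z = a + b x with x ^+ 2 = n < 0, the element z ^+ 2 is rational only if
    a b = 0, and b ^+ 2 n < 0 excludes a = 0; so z is rational. *)
Lemma imaginary_quadratic_square (K : fieldExtType rat) (d : int) (z : K) :
  is_imaginary_quadratic_field K -> 0 < d -> z ^+ 2 = d%:~R -> is_square d.
Proof.
move=> [n [x [n0 x2 span]]] d0.
have algI : injective (fun a : rat => a%:A : K) by exact: (fmorph_inj (in_alg K)).
have algz (m : int) : (m%:~R : K) = (m%:~R : rat)%:A.
  by rewrite -[RHS]/(in_alg K _) rmorph_int.
have [a [b ->]] : exists a b : rat, z = a%:A + b *: x.
  have /Fadjoin_polyP[p p1 ->] : z \in <<1; x>>%VS by rewrite span memvf.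
  elim/poly_ind: p p1 => [|p c IH] p1; first by exists 0, 0; rewrite horner0 !scale0r addr0.
  have [|a [b pE]] := IH.
    by apply/polyOverP => i; have /polyOverP/(_ i.+1) := p1; rewrite coefD coefMX coefC addr0.
  have /vlineP[c' cE] : c \in 1%VS.
    by have /polyOverP/(_ 0%N) := p1; rewrite coefD coefMX coefC add0r.
  exists (b * n%:~R + c'), a; rewrite hornerMXaddC pE cE mulrDl -scalerAl mul1r.
  by rewrite -scalerAl -expr2 x2 algz scalerA scalerDl [RHS]addrC addrA.
move=> z2.
have zE : (a ^+ 2 + b ^+ 2 * n%:~R - d%:~R)%:A + (2 * a * b) *: x = 0.
  rewrite -[(2 * a * b) *: x]mulr_algl -[b *: x]mulr_algl in z2 *.
  rewrite -!/(in_alg K _) rmorphB rmorphD !rmorphM !rmorph_int rmorph_nat -z2 -x2 /=.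
  ring.
have [ab0|ab0] := eqVneq (2 * a * b) 0.
  move: zE; rewrite ab0 scale0r addr0 -(scale0r 1) => /algI.
  move/eqP: ab0; rewrite !mulf_eq0 /= => /orP[/eqP->|/eqP->].
  - rewrite expr0n add0r => /eqP; rewrite subr_eq0 => /eqP h.
    have : (0 : rat) < d%:~R by rewrite ltr0z.
    by rewrite -h ltNge mulr_ge0_le0 ?sqr_ge0 // lerz0 ltW.
  - rewrite expr0n mul0r addr0 => /eqP; rewrite subr_eq0 => /eqP.
    exact: rat_square_int.
have [c xc] : exists c : rat, x = c%:A.
  exists (- (a ^+ 2 + b ^+ 2 * n%:~R - d%:~R) / (2 * a * b)).
  rewrite mulrC -scalerA scaleNr; move/eqP: zE; rewrite addrC addr_eq0 => /eqP <-.
  by rewrite scalerA mulVf // scale1r.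
move: x2; rewrite xc algz -[c%:A]/(in_alg K c) -rmorphXn => /algI h.
have : (n%:~R : rat) < 0 by rewrite ltrz0.
by rewrite -h ltNge sqr_ge0.
Qed.

(** The imaginary coordinates of q ^+ 2 are those of q times twice the real part
    of q, and that real part is not 0 because a purely imaginary quaternion has a
    negative square. *)
Lemma hamilton_sqrt_real (F : realFieldType) (q : hamilton F) (c : F) :
  0 < c -> q ^+ 2 = c%:A -> exists2 r : F, r ^+ 2 = c & q = r%:A.
Proof.
case: q => a b i j c0; rewrite expr2 => -[]; rewrite !mulr0 !mulr1 => h1 h2 h3 h4.
have a0 : a != 0 by apply/eqP => a0; move: h1; rewrite a0; nra.
have aI (x : F) : a * x + a * x = 0 -> x = 0.
  move/eqP; rewrite -mulr2n -mulr_natl !mulf_eq0 pnatr_eq0 (negPf a0) => /eqP; exact.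
have b0 : b = 0 by apply: aI; rewrite -[RHS]h2; ring.
have i0 : i = 0 by apply: aI; rewrite -[RHS]h3; ring.
have j0 : j = 0 by apply: aI; rewrite -[RHS]h4; ring.
exists a; first by rewrite -h1 b0 i0 j0; ring.
by rewrite b0 i0 j0 /GRing.scale /= !mulr0 mulr1.
Qed.

(** The image of z in the real quaternions is a real scalar r.  Comparing a nonzero
    coordinate of 1 in a rational basis of B with that of z = r 1 shows that r is
    rational. *)
Lemma definite_quaternion_square (R : realType) (B : falgType rat) (d : int) (z : B) :
  is_definite_quaternion_algebra R B -> 0 < d -> z ^+ 2 = d%:~R -> is_square d.
Proof.
move=> [_ [f /bij_inj finj]] d0 z2.
pose phi : {rmorphism rat -> R} := ratr.
pose Z : base_change B phi := base_change_in phi z.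
have Z2 : Z ^+ 2 = (d%:~R : R)%:A.
  rewrite expr2 -[LHS]base_change_in_mul -expr2 z2.
  apply/rowP => k; rewrite !mxE -(rmorph_int (in_alg B)) linearZ /= rmorphM.
  by rewrite rmorph_int.
have [||r r2 fZ] := @hamilton_sqrt_real R (f Z) d%:~R.
- by rewrite ltr0z.
- by rewrite -rmorphXn /= Z2 rmorph_alg.
have ZE : Z = r%:A by apply: finj; rewrite fZ rmorph_alg.
have [k k0] : exists k, coord (vbasis {:B}) k 1 != 0.
  apply/existsP; rewrite -negb_forall; apply: contra (oner_neq0 B) => /forallP h.
  rewrite (coord_vbasis (memvf 1)) big1 // => i _.
  by move: (h i) => /eqP ->; rewrite scale0r.
have /(congr1 (fun w : base_change B phi => w 0 k)) := ZE; rewrite !mxE => zk.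
apply: (@rat_square_int _ (coord (vbasis {:B}) k z / coord (vbasis {:B}) k 1)).
apply: (fmorph_inj phi); rewrite rmorphXn rmorph_int fmorph_div /= -r2.
by rewrite -/(phi _) zk mulfK // fmorph_eq0.
Qed.

Lemma alg_isomorphic_sqrt (A B : algType rat) (d : int) :
  alg_isomorphic A B -> (exists z : B, z ^+ 2 = d%:~R) ->
  exists z : A, z ^+ 2 = d%:~R.
Proof.
move=> [f [g fK gK]] [z z2]; exists (g z); apply: (can_inj fK).
by rewrite rmorphXn /= gK z2 rmorph_int.
Qed.

Unset Implicit Arguments.
Local Close Scope complex_scope.

Theorem corollary3 (R : realType) (L : lattice R) (d : int) :
  is_abelian_surface L -> d < 0 -> admits_sqrt_mult L d ->
  (exists d' : int, [/\ 0 < d', ~ is_square d' & admits_sqrt_mult L d']) /\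
  ~ (exists K : fieldExtType rat,
       is_imaginary_quadratic_field K /\ alg_isomorphic K (EndQ L)) /\
  ~ (exists B : falgType rat,
       is_definite_quaternion_algebra R B /\ alg_isomorphic B (EndQ L)).
Proof.
move=> surfaceL d0 multL.
have [d' [d'0 nsq mult']] := real_multiplication surfaceL d0 multL.
have root := EndQ_sqrt mult'.
split; first by exists d'.
split=> [[K [imK /alg_isomorphic_sqrt/(_ root)[z z2]]]|].
  exact/nsq/(imaginary_quadratic_square imK d'0 z2).
move=> [B [defB /alg_isomorphic_sqrt/(_ root)[z z2]]].
exact/nsq/(definite_quaternion_square defB d'0 z2).
Qed.
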